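(* A Hausdorff space $X$ is H-closed if and only if for every open cover $\mathcal V$ of $X$ there exists a finite family $\mathcal W\subseteq\mathcal V$ such that $X=\bigcup_{W\in\mathcal W}\widehat{W}$.
   Context: A Hausdorff space $X$ is H-closed if every open cover $\mathcal V$ of $X$ has a finite subfamily $\mathcal W$ with $X=\bigcup_{W\in\mathcal W}cl\,W$. An open ultrafilter on a Hausdorff space $X$ is a maximal filter in the family of open subsets of $X$ (its members are nonempty open sets); it converges to $x\in X$ if it contains every open set containing $x$. $EX$ is the set of all convergent open ultrafilters on $X$. A section is a function $b:X\to EX$ such that $b(x)$ converges to $x$ for every $x\in X$. For a section $b$ and an open set $U$ let $\widehat{U}_b=\{x\in X: U\in b(x)\}$, and for $A\subseteq X$ let $c_b(A)=\{x\in X:\widehat{U}_b\cap A\neq\varnothing\text{ for every open }U\ni x\}$. $A$ is $c_b$-closed if $c_b(A)=A$. For $A\subseteq X$, $aL(A,X)$ is the least infinite cardinal $\kappa$ such that every cover $\mathcal V$ of $A$ by open sets of $X$ has a subfamily $\mathcal W$ with $|\mathcal W|\leq\kappa$ and $A\subseteq\bigcup_{W\in\mathcal W}cl\,W$. Put $aL^b(X)=\sup\{aL(C,X): C\text{ is }c_b\text{-closed}\}+\aleph_0$ and $aL'(X)=\min\{aL^b(X): b\text{ a section}\}$. Fix any section $b'$ with $aL^{b'}(X)=aL'(X)$ and write $\widehat{U}=\widehat{U}_{b'}$. *)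

(* Defs.v *)
From mathcomp Require Import all_boot all_order.
From mathcomp Require Import all_classical topology.

Set Implicit Arguments.
Unset Strict Implicit.
Unset Printing Implicit Defensive.

Local Open Scope classical_set_scope.
Local Open Scope card_scope.

(* A cardinal is represented by any type of that cardinality, compared with
   [#<=] and [#=].  The cardinal functions aL(A, X), aL^b(X) and aL'(X) are thus
   relations [is_aL A K], [is_aLb b K], [is_aL' X K], each holding for exactly
   the types K of the relevant cardinality. *)

Definition least_cardinal (P : Type -> Prop) (K : Type) : Prop :=
  P K /\ forall L : Type, P L -> [set: K] #<= [set: L].

Definition cardinal_sup (P : Type -> Prop) (K : Type) : Prop :=
  least_cardinal (fun L => forall M : Type, P M -> [set: M] #<= [set: L]) K.

Section HClosed.
Context {X : topologicalType}.

Definition is_open_cover (A : set X) (V : set (set X)) : Prop :=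
  V `<=` open /\ A `<=` \bigcup_(U in V) U.

Definition open_filter (F : set (set X)) : Prop :=
  [/\ F `<=` open, F setT, ~ F set0,
      forall U V, F U -> F V -> F (U `&` V) &
      forall U V, F U -> open V -> U `<=` V -> F V].

Definition open_ultrafilter (F : set (set X)) : Prop :=
  open_filter F /\ forall G, open_filter G -> F `<=` G -> G = F.

Definition open_converges (F : set (set X)) (x : X) : Prop :=
  forall U, open U -> U x -> F U.

End HClosed.

(* Only meant for Hausdorff [X]. *)
Definition H_closed (X : topologicalType) : Prop :=
  forall V : set (set X), is_open_cover setT V ->
    exists W : set (set X), [/\ finite_set W, W `<=` V &
      [set: X] = \bigcup_(U in W) closure U].

Definition EX (X : topologicalType) : set (set (set X)) :=
  [set F | open_ultrafilter F /\ exists x, open_converges F x].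
Arguments EX X : clear implicits.

Section AlmostLindelof.
Context {X : topologicalType}.

Definition is_section (b : X -> EX X) : Prop :=
  forall x, open_converges (val (b x)) x.

Definition hat (b : X -> EX X) (U : set X) : set X :=
  [set x | val (b x) U].

Definition c_ (b : X -> EX X) (A : set X) : set X :=
  [set x | forall U, open U -> U x -> hat b U `&` A !=set0].

Definition c_closed (b : X -> EX X) (A : set X) : Prop := c_ b A = A.

Definition is_aL (A : set X) : Type -> Prop :=
  least_cardinal (fun K => infinite_set [set: K] /\
    forall V : set (set X), is_open_cover A V ->
      exists W : set (set X), [/\ W `<=` V, W #<= [set: K] &
        A `<=` \bigcup_(U in W) closure U]).

Definition is_aLb (b : X -> EX X) (K : Type) : Prop :=
  exists S : Type,
    cardinal_sup (fun L => exists C, c_closed b C /\ is_aL C L) S /\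
    [set: K] #= [set: S + nat].

End AlmostLindelof.

Definition is_aL' (X : topologicalType) : Type -> Prop :=
  least_cardinal (fun K => exists b : X -> EX X, is_section b /\ is_aLb b K).

(* Main.v *)
Require Import Defs.
From mathcomp Require Import all_boot all_order.
From mathcomp Require Import all_classical topology.
Local Open Scope classical_set_scope.

(** If the closures of finitely many open sets cover [X], their union is dense,
    so it meets every member of any open ultrafilter; hence one of these sets
    already belongs to the ultrafilter.  Applied to each [b'(x)], this refines
    closures to hats.  Conversely a hat lies inside the closure because [b'(x)]
    contains all open neighbourhoods of [x]. *)

(** The traces on [U] of the members of [F] generate an open filter [H] containing both [F] and [U];
    maximality forces [H] to equal [F]. *)
Lemma open_ultrafilter_meets (X : topologicalType) (F : set (set X)) (U : set X) :
  open_ultrafilter F -> open U -> (forall G, F G -> G `&` U !=set0) -> F U.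
Proof.
move=> [[Fopen FT F0 FI Fup] Fmax] oU meetU.
pose H := [set V : set X | open V /\ exists2 G, F G & G `&` U `<=` V].
have filterH : open_filter H.
  split.
  - by move=> V [].
  - by split; [exact: openT | exists setT].
  (* Properness of [H] is exactly where [meetU] enters. *)
  - case=> _ [G FG]; have [x Ux] := meetU _ FG.
    by move=> /(_ x Ux).
  - move=> V1 V2 [oV1 [G1 FG1 s1]] [oV2 [G2 FG2 s2]]; split; first exact: openI.
    exists (G1 `&` G2); first exact: FI.
    by move=> x [[G1x G2x] Ux]; split; [apply: s1 | apply: s2].
  - move=> V1 V2 [_ [G FG s]] oV2 V12; split => //.
    by exists G => // x /s /V12.
have FH : F `<=` H.
  by move=> V FV; split; [exact: Fopen | exists V => // x []].
rewrite -(Fmax _ filterH FH); split => //.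
by exists setT => // x [].
Qed.

(** Finitely many witnesses, one for each member of [W], can be intersected without leaving [F]. *)
Lemma open_filter_disjoint_finite (X : topologicalType) (F W : set (set X)) :
  open_filter F -> finite_set W ->
  (forall U, W U -> exists2 G, F G & G `&` U = set0) ->
  exists2 G, F G & forall U, W U -> G `&` U = set0.
Proof.
move=> [_ FT _ FI _] /finite_seqP[s ->].
elim: s => [|U s IHs] disj; first by exists setT.
have [G1 FG1 G1U] : exists2 G, F G & G `&` U = set0.
  by apply: disj; rewrite /= mem_head.
have [G2 FG2 G2s] : exists2 G, F G & forall V, [set` s] V -> G `&` V = set0.
  by apply: IHs => V /= sV; apply: disj; rewrite /= inE sV orbT.
exists (G1 `&` G2); first exact: FI.
move=> V /=; rewrite inE => /orP[/eqP ->|/G2s G2V].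
  by rewrite setIAC G1U set0I.
by rewrite -setIA G2V setI0.
Qed.

(** Otherwise each member of [W] misses some member of [F], so a single nonempty open [G] in [F]
    misses them all; but a point of [G] lies in the closure of one of them, which [G] must then
    meet. *)
Lemma open_ultrafilter_closure_cover (X : topologicalType) (F W : set (set X)) :
  open_ultrafilter F -> finite_set W -> W `<=` open ->
  [set: X] = \bigcup_(U in W) closure U -> exists2 U, W U & F U.
Proof.
move=> uF finW oW covW; apply: contrapT => noU.
have [[Fopen _ F0 _ _] _] := uF.
have [G FG GW] : exists2 G, F G & forall U, W U -> G `&` U = set0.
  apply: open_filter_disjoint_finite => //; first by case: uF.
  move=> U WU; apply: contrapT => nG; apply: noU; exists U => //.
  apply: open_ultrafilter_meets => //; first exact: oW.
  by move=> G FG; apply/set0P/eqP => GU; apply: nG; exists G.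
have [x Gx] : G !=set0 by apply/set0P/eqP => G0; apply: F0; rewrite -G0.
have [U WU clUx] : (\bigcup_(U in W) closure U) x by rewrite -covW.
have [y [Uy Gy]] := clUx G (open_nbhs_nbhs (conj (Fopen _ FG) Gx)).
by have : (G `&` U) y by []; rewrite GW.
Qed.

Lemma hat_sub_closure (X : topologicalType) (b : X -> EX X) (U : set X) :
  is_section b -> hat b U `<=` closure U.
Proof.
move=> sb x Ux B; rewrite nbhsE => -[V [oV Vx] VB].
have [[[_ _ F0 FI _] _] _] := set_valP (b x).
(* Both sets belong to [b x], [V] by convergence, and a filter excludes the empty set. *)
have [y [Uy Vy]] : U `&` V !=set0.
  apply/set0P/eqP => UV0; apply: F0; rewrite -UV0.
  by apply: FI => //; exact: sb.
by exists y; split => //; exact: VB.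
Qed.

Theorem theorem3p4 (X : topologicalType) (hX : hausdorff_space X)
    (b' : X -> EX X) (hb' : is_section b')
    (haL : exists K : Type, is_aLb b' K /\ is_aL' X K) :
  H_closed X <->
  forall V : set (set X), is_open_cover [set: X] V ->
    exists W : set (set X), [/\ finite_set W, W `<=` V &
      [set: X] = \bigcup_(U in W) hat b' U].
Proof.
split=> cov V covV; have [W [finW WV covW]] := cov V covV; exists W; split=> //.
- apply/esym/seteqP; split=> // x _.
  have [uF _] := set_valP (b' x).
  have oW : W `<=` open by move=> U /WV; exact: covV.1.
  (* The same [W] serves every [x]; only the chosen member [U] depends on the point. *)
  have [U WU FU] := open_ultrafilter_closure_cover _ _ _ uF finW oW covW.
  by exists U.
- apply/esym/seteqP; split=> // x _.
  have [U WU Ux] : (\bigcup_(U in W) hat b' U) x by rewrite -covW.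
  by exists U => //; exact: hat_sub_closure Ux.
Qed.
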